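(* Suppose $G$ is a compactly generated, totally disconnected, locally compact group admitting a proper Lipschitz action on a bounded-degree amenable graph. Then $G$ is geometrically amenable.
   Context: Groups. A locally compact group $G$ with (left) Haar measure $\mu$ is geometrically amenable if for every compact $K\subseteq G$ and every $\varepsilon>0$ there is a compact set $U\subseteq G$ of positive measure with $\mu(UK)/\mu(U)\le 1+\varepsilon$. Graphs. For a set $A$ of vertices of a graph $\Gamma$, $\partial A$ is the set of vertices not in $A$ that have a neighbour in $A$. The Cheeger constant is $\mathrm{h}(\Gamma)=\inf |\partial A|/|A|$ over finite non-empty sets $A$ of vertices, and $\Gamma$ is amenable if $\mathrm{h}(\Gamma)=0$. Actions. All actions of topological groups on graphs are by graph automorphisms and continuous, i.e. the induced homomorphism $G\to\mathrm{Aut}(\Gamma)$ is continuous for the topology of pointwise convergence on $\mathrm{Aut}(\Gamma)$. An action is proper if vertex stabilisers are compact in $G$. For a compactly generated locally compact group $G$ acting properly on a locally finite graph $\Gamma$ and $C>0$, the action is $C$-Lipschitz with respect to a compact symmetric generating set $S$ of $G$ if in each orbit there is some vertex $x$ such that the orbit map $(G,S)\to G\cdot x$, $g\mapsto g\cdot x$, is $C$-Lipschitz, where $(G,S)$ is $G$ with the word metric of $S$ and $G\cdot x$ carries the graph distance of $\Gamma$. The action is $C$-Lipschitz if this holds for some $S$, and Lipschitz if it is $C$-Lipschitz for some $C>0$. *)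

(* Defs.v *)
From HB Require Import structures.
From mathcomp Require Import all_boot all_order all_algebra.
From mathcomp Require Import all_classical all_reals all_analysis.

Set Implicit Arguments.
Unset Strict Implicit.
Unset Printing Implicit Defensive.

Import Order.TTheory GRing.Theory Num.Theory.

Local Open Scope classical_set_scope.
Local Open Scope card_scope.
Local Open Scope ring_scope.

HB.mixin Record isTopologicalGroup G & Group G & PointedTopological G := {
  mulg_continuous : continuous (fun x : G * G => (x.1 * x.2)%g) ;
  invg_continuous : continuous (fun x : G => (x^-1)%g)
}.

(* The base point inherited from [ptopologicalType] is only there because
   measurable spaces are pointed in the library; it need not be [1]. *)
#[short(type="topologicalGroupType")]
HB.structure Definition TopologicalGroup :=
  {G of Group G & PointedTopological G & isTopologicalGroup G}.

Section Generation.
Variable G : topologicalGroupType.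
Implicit Types S H : set G.

Definition is_subgroup H : Prop :=
  [/\ H 1%g, (forall x y, H x -> H y -> H (x * y)%g)
    & (forall x, H x -> H (x^-1)%g)].

Definition generates S : Prop := smallest is_subgroup S = [set: G].

Definition symmetric_set S : Prop := forall x, S x -> S (x^-1)%g.

Definition compactly_generated : Prop :=
  exists2 S : set G, compact S & generates S.

(* Inverses of elements of [S] are not allowed as letters: this is the word
   length for symmetric [S]. *)
Definition word_length (R : realType) S (g : G) : \bar R :=
  ereal_inf [set (size s)%:R%:E | s in
    [set s : seq G | [set` s] `<=` S /\ (\prod_(x <- s) x)%g = g]].

(* The left-invariant word metric, i.e. that of the right Cayley graph. *)
Definition word_metric (R : realType) S (g h : G) : \bar R :=
  word_length R S (g^-1 * h)%g.

End Generation.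

Notation borel G := (g_sigma_algebraType (@open G)).

Section Haar.
Variables (R : realType) (G : topologicalGroupType).

Record left_haar (mu : {measure set (borel G) -> \bar R}) : Prop := {
  haar_invariant : forall (g : G) (A : set G), measurable (A : set (borel G)) ->
    mu [set (g * x)%g | x in A] = mu A ;
  haar_compact : forall K : set G, compact K -> (mu K < +oo)%E ;
  haar_neq0 : mu [set: G] <> 0%E ;
  haar_outer : forall A : set G, measurable (A : set (borel G)) ->
    mu A = ereal_inf [set mu O | O in [set O : set G | open O /\ A `<=` O]] ;
  haar_inner : forall O : set G, open O ->
    mu O = ereal_sup [set mu K | K in [set K : set G | compact K /\ K `<=` O]]
}.

Definition geometrically_amenable (mu : {measure set (borel G) -> \bar R}) : Prop :=
  forall (K : set G) (eps : R), compact K -> (0 < eps)%R ->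
  exists U : set G, [/\ compact U, (0 < mu U)%E &
    (mu [set (u * k)%g | u in U & k in K] / mu U <= (1 + eps)%:E)%E].

End Haar.

Record graph := Graph {
  vertex :> choiceType ;
  adj : rel vertex ;
  adj_sym : symmetric adj ;
  adj_irr : irreflexive adj
}.

Section Graphs.
Variable Gamma : graph.

(* [+oo] between distinct connected components *)
Definition graph_dist (R : realType) (x y : Gamma) : \bar R :=
  ereal_inf [set (size p)%:R%:E | p in
    [set p : seq Gamma | path (@adj Gamma) x p /\ last x p = y]].

Definition bounded_degree : Prop :=
  exists d : nat, forall x : Gamma, [set y | adj x y] #<= `I_d.

Definition boundary (A : set Gamma) : set Gamma :=
  [set y | ~ A y /\ exists2 x, A x & adj x y].

Definition cheeger (R : realType) : \bar R :=
  ereal_inf [set (counting (boundary A) / counting A)%E | A in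
    [set A : set Gamma | finite_set A /\ A !=set0]].

Definition amenable_graph (R : realType) : Prop := cheeger R = 0%E.

End Graphs.

(* [Aut Gamma] has the topology induced from [Gamma -> Gamma] with pointwise
   convergence, the vertex set being discrete, so continuity of [G -> Aut Gamma]
   is continuity of [act] into that function space. *)
Record graph_action (G : topologicalGroupType) (Gamma : graph) := GraphAction {
  act :> G -> Gamma -> Gamma ;
  act1 : forall x, act 1%g x = x ;
  actM : forall g h x, act (g * h)%g x = act g (act h x) ;
  act_adj : forall g x y, adj (act g x) (act g y) = adj x y ;
  act_continuous : continuous
    (act : G -> {ptws discrete_topology Gamma -> discrete_topology Gamma})
}.

Section Actions.
Variables (G : topologicalGroupType) (Gamma : graph) (a : graph_action G Gamma).

Definition stabiliser (x : Gamma) : set G := [set g | a g x = x].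

Definition orbit_of (x : Gamma) : set Gamma := range (fun g => a g x).

Definition proper_action : Prop := forall x, compact (stabiliser x).

Definition lipschitz_wrt (R : realType) (C : R) (S : set G) : Prop :=
  forall y : Gamma, exists2 x, orbit_of y x &
    forall g h : G, (graph_dist R (a g x) (a h x) <= C%:E * word_metric R S g h)%E.

Definition C_lipschitz (R : realType) (C : R) : Prop :=
  exists S : set G,
    [/\ compact S, symmetric_set S, generates S & lipschitz_wrt C S].

Definition lipschitz_action (R : realType) : Prop :=
  exists2 C : R, (0 < C)%R & C_lipschitz C.

End Actions.

(* Main.v *)
Require Import Defs.
From HB Require Import structures.
From mathcomp Require Import all_boot all_order all_algebra finmap.
From mathcomp Require Import all_classical all_reals all_analysis.

Set Implicit Arguments.
Unset Strict Implicit.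
Unset Printing Implicit Defensive.

Import Order.TTheory GRing.Theory Num.Theory.

Local Open Scope classical_set_scope.
Local Open Scope ring_scope.

(** The Folner sets of the group are pulled back from those of the graph along
    an orbit map.

    Fix a compact set K and eps > 0. Vertex stabilisers are open because the
    action is continuous, and compact because it is proper, so they have
    finite positive Haar measure. If x is a vertex and F a finite set of
    vertices, the set of all g with g x in F is a disjoint union of left
    cosets of the stabiliser of x, one for each element of F in the orbit of
    x. By left invariance its measure is the number of these elements times
    the measure of the stabiliser ([haar_orbit_preimage]).

    The Lipschitz condition gives, in each orbit, a base point x such that g x
    and g s x stay at bounded distance for all g in G and s in S, with a bound
    that is the same for all orbits. To use it for K instead of S one needs K
    to be covered by finitely many powers of S. Compactness of S alone gives
    no neighbourhood of 1 inside a power of S; it is Haar measure that does: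
    G is the countable union of the powers of S, so one of them has positive
    measure, and a Steinhaus argument applies to it ([compact_sub_words]).
    Hence there is a single radius M such that k in K moves g x to g k x
    within distance M, for every good base point x.

    In a bounded-degree amenable graph there is a finite set A whose
    M-neighbourhood adds a set E of at most eps |A| new vertices
    ([amenable_small_thickening]). The graph may meet infinitely many orbits
    and A may be spread over many of them, but the inequality |E| <= eps |A|
    is a sum over orbits, so it holds inside some orbit that meets A
    ([fibre_pigeonhole]). Let x be the good base point of that orbit and let U
    be the set of all g with g x in A. Then U is compact and open, and every
    g in U K has g x in A or in E, so mu (U K) <= (1 + eps) mu U. *)

(** * Averaging over the fibres of a map *)

(** If the inequality failed in every fibre that meets [A], summing over these
    fibres would contradict the hypothesis. The induction removes one fibre at
    a time: removing a fibre in which [E] is too large keeps the inequality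
    for what remains, and makes it strict, so that [A] cannot be exhausted. *)
Lemma fibre_pigeonhole {R : realFieldType} {T T' : eqType} (f : T -> T')
    (eps : R) (A E : seq T) :
  A != [::] -> (size E)%:R <= eps * (size A)%:R ->
  exists2 x, x \in A &
    (count (fun y => f y == f x) E)%:R
      <= eps * (count (fun y => f y == f x) A)%:R.
Proof.
have [n] := ubnP (size A); elim: n A E => // n IHn [//|x A] E ltAn _ leEA.
set fib := fun z y => f y == f z; set A0 := x :: A.
have [lefib|gtfib] := leP (count (fib x) E)%:R (eps * (count (fib x) A0)%:R).
  by exists x; rewrite ?mem_head.
pose A' := [seq z <- A0 | predC (fib x) z].
pose E' := [seq z <- E | predC (fib x) z].
have ltE'A' : (size E')%:R < eps * (size A')%:R.
  rewrite !size_filter -(ltrD2l (count (fib x) E)%:R) -natrD count_predC.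
  apply: le_lt_trans leEA _.
  by rewrite -(count_predC (fib x) A0) natrD mulrDr ltrD2r.
have A'0 : A' != [::].
  by apply: contraTneq ltE'A' => ->; rewrite mulr0 -leNgt ler0n.
have leA'n : (size A' < n)%N.
  rewrite size_filter /= {1}/fib eqxx add0n.
  by apply: leq_ltn_trans (count_size _ _) _.
have [y yA' ley] := IHn A' E' leA'n A'0 (ltW ltE'A').
move: yA'; rewrite mem_filter => /andP[fyx yA]; exists y => //.
have fibD s : count (fib y) [seq z <- s | predC (fib x) z] = count (fib y) s.
  rewrite count_filter; apply: eq_count => z /=.
  by rewrite andb_idr// => /eqP fzy; rewrite /fib fzy.
by move: ley; rewrite !fibD.
Qed.

(** * Thickenings of sets of vertices *)

Section Thickening.
Variables (R : realType) (Gamma : graph).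
Implicit Types (s A D : seq Gamma) (x y : Gamma).

Definition neighbours x : seq Gamma := fset_set [set y | adj x y].

Definition thicken s : seq Gamma := flatten [seq x :: neighbours x | x <- s].

Lemma bounded_degree_neighbours :
  bounded_degree Gamma ->
  exists d, (forall x, size (neighbours x) <= d)%N /\
    forall x y, (y \in neighbours x) = adj x y.
Proof.
move=> [d degd]; exists d; split=> [x|x y]; first exact: geq_card_fset_set.
rewrite in_fset_set; first by apply/idP/idP; rewrite inE.
exact: card_le_finite (degd x) (finite_II d).
Qed.

Lemma size_iter_thicken d n s :
  (forall x, size (neighbours x) <= d)%N ->
  (size (iter n thicken s) <= d.+1 ^ n * size s)%N.
Proof.
move=> degd; elim: n => [|n IHn]; first by rewrite mul1n.
rewrite expnS -mulnA; apply: (@leq_trans (d.+1 * size (iter n thicken s))%N).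
  rewrite iterS; elim: (iter n thicken s) => [|x t IHt]; first by rewrite muln0.
  rewrite /thicken /= size_cat -/(thicken t) mulnS -addSn leq_add//; exact: degd.
by rewrite leq_mul2l IHn orbT.
Qed.

Lemma sub_thicken s : {subset s <= thicken s}.
Proof. by move=> x xs; apply/flatten_mapP; exists x; rewrite ?mem_head. Qed.

(** A path leaving [A] enters [D] at its first step outside [A], and then has
    one step fewer to move away from [D] than its length. Starting from [D]
    instead of [A] is what makes the bound on the thickening proportional to
    the boundary; allowing [n] thickenings rather than [n - 1] only costs a
    constant factor. *)
Lemma path_escape A D x p n :
  (forall x y, (y \in neighbours x) = adj x y) ->
  (forall x y, x \in A -> adj x y -> y \in A ++ D) ->
  path (@adj Gamma) x p -> x \in A -> (size p <= n)%N ->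
  last x p \in A ++ iter n thicken D.
Proof.
move=> nbE bdD; elim/last_ind: p n => [|p y IHp] n; first by rewrite mem_cat => _ ->.
rewrite rcons_path last_rcons size_rcons => /andP[xp ady] xA; case: n => // n lpn.
have := IHp n xp xA lpn; rewrite !mem_cat => /orP[lA|lD]; apply/orP.
  have := bdD _ _ lA ady; rewrite mem_cat => /orP[->|yD]; [by left|right].
  by elim: n.+1 => // m IHm; apply: sub_thicken.
right; apply/flatten_mapP; exists (last x p) => //.
by rewrite inE nbE ady orbT.
Qed.

Lemma amenable_small_boundary (delta : R) :
  bounded_degree Gamma -> amenable_graph Gamma R -> 0 < delta ->
  exists A D, [/\ A != [::], uniq A, (size D)%:R <= delta * (size A)%:R &
    forall x y, x \in A -> adj x y -> y \in A ++ D].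
Proof.
move=> bdG ameG delta0.
have : (cheeger Gamma R < delta%:E)%E by rewrite ameG lte_fin.
move=> /ereal_inf_lt[_ [A [finA [a Aa]] <-]].
have A0 : (0 < size (fset_set A))%N.
  by rewrite cardfs_gt0; apply/fset0Pn; exists a; rewrite in_fset_set// mem_set.
rewrite /counting (asboolT finA) inver pnatr_eq0 eqn0Ngt A0.
(* An infinite boundary would make the quotient infinite, hence not small. *)
case: asboolP => [finD|_]; last by rewrite gt0_mulye// lte_fin invr_gt0 ltr0n.
rewrite lte_fin ltr_pdivrMr ?ltr0n// => /ltW ltDA.
exists (fset_set A), (fset_set (boundary A)); split=> //.
  by rewrite -size_eq0 -lt0n.
move=> x y; rewrite mem_cat !in_fset_set// !inE => Ax xy; apply/orP.
by have [Ay|nAy] := pselect (A y); [left|right]; rewrite inE//; split=> //; exists x.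
Qed.

(** With degrees bounded by [d], [n] thickenings multiply the size by at most
    [d.+1 ^ n]; it is enough to start from a set whose boundary is smaller
    than [eps] by this factor. *)
Lemma amenable_small_thickening (n : nat) (eps : R) :
  bounded_degree Gamma -> amenable_graph Gamma R -> 0 < eps ->
  exists A E, [/\ A != [::], uniq (A ++ E), (size E)%:R <= eps * (size A)%:R &
    forall x p, path (@adj Gamma) x p -> x \in A -> (size p <= n)%N ->
      last x p \in A ++ E].
Proof.
move=> bdG ameG eps0; have [d [degd nbE]] := bounded_degree_neighbours bdG.
have dn0 : 0 < (d.+1 ^ n)%:R :> R by rewrite ltr0n expn_gt0.
have [|A [D [A0 uA DA bdD]]] :=
  @amenable_small_boundary (eps / (d.+1 ^ n)%:R) bdG ameG.
  exact: divr_gt0.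
pose E := [seq y <- undup (iter n thicken D) | y \notin A].
exists A, E; split=> //.
- rewrite cat_uniq uA filter_uniq ?undup_uniq// andbT.
  by apply/hasPn => y; rewrite mem_filter => /andP[].
- apply: (@le_trans _ _ ((d.+1 ^ n)%:R * (size D)%:R)).
    rewrite -natrM ler_nat size_filter; apply: leq_trans (count_size _ _) _.
    exact: leq_trans (size_undup _) (size_iter_thicken _ _ degd).
  by rewrite -ler_pdivlMl// mulrA [_^-1 * _]mulrC.
- move=> x p xp xA lpn; have := path_escape nbE bdD xp xA lpn.
  rewrite !mem_cat mem_filter mem_undup => /orP[->//|->].
  by rewrite andbT orbN.
Qed.

End Thickening.

(** * Topological groups *)

Section TopologicalGroups.
Variable G : topologicalGroupType.
Implicit Types (A B K S : set G) (g h x y : G).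

Lemma cvg_mulg (T : Type) (F : set_system T) (f f' : T -> G) g h :
  Filter F -> f @ F --> g -> f' @ F --> h ->
  (f x * f' x)%g @[x --> F] --> (g * h)%g.
Proof.
move=> FF fg fh; apply: (continuous2_cvg FF (h := fun x y : G => (x * y)%g) _ fg fh).
exact: (mulg_continuous (g, h)).
Qed.

Lemma lmulg_continuous g : continuous (fun x => (g * x)%g).
Proof. by move=> x; apply: cvg_mulg; [exact: cvg_cst|exact: cvg_id]. Qed.

Lemma rmulg_continuous g : continuous (fun x => (x * g)%g).
Proof. by move=> x; apply: cvg_mulg; [exact: cvg_id|exact: cvg_cst]. Qed.

Lemma lcosetE g A : [set (g * x)%g | x in A] = (fun x => (g^-1 * x)%g) @^-1` A.
Proof.
apply/seteqP; split=> [_ [x Ax <-]|x Ax] /=; first by rewrite mulgA mulVg mul1g.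
by exists (g^-1 * x)%g; rewrite // mulgA mulgV mul1g.
Qed.

Lemma lcoset_open g A : open A -> open [set (g * x)%g | x in A].
Proof.
move=> oA; rewrite lcosetE; apply: open_comp => // x _; exact: lmulg_continuous.
Qed.

Lemma rcoset_open g A : open A -> open [set (x * g)%g | x in A].
Proof.
move=> oA.
have -> : [set (x * g)%g | x in A] = (fun x => (x * g^-1)%g) @^-1` A.
  apply/seteqP; split=> [_ [x Ax <-]|x Ax] /=.
    by rewrite -mulgA mulgV mulg1.
  by exists (x * g^-1)%g; rewrite // -mulgA mulVg mulg1.
by apply: open_comp => // x _; exact: rmulg_continuous.
Qed.

Lemma lcoset_compact g A : compact A -> compact [set (g * x)%g | x in A].
Proof.
move=> cA; apply: continuous_compact => //.
exact/continuous_subspaceT/lmulg_continuous.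
Qed.

Lemma mulset_compact A B :
  compact A -> compact B -> compact [set (x * y)%g | x in A & y in B].
Proof.
move=> cA cB.
rewrite (_ : [set _ | _ in _ & _ in _] =
             [set (z.1 * z.2)%g | z in A `*` B]).
  apply: continuous_compact; last exact: compact_setX.
  exact/continuous_subspaceT/mulg_continuous.
apply/seteqP; split=> [_ [x Ax [y By <-]]|_ [[x y] [Ax By] <-]].
  by exists (x, y).
by exists x => //; exists y.
Qed.

Lemma mulset_open A B : open A -> open [set (x * y)%g | x in A & y in B].
Proof.
move=> oA.
rewrite (_ : [set _ | _ in _ & _ in _] =
             \bigcup_(y in B) [set (x * y)%g | x in A]).
  by apply: bigcup_open => y _; exact: rcoset_open.
apply/seteqP; split=> [_ [x Ax [y By <-]]|_ [y By [x Ax <-]]].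
  by exists y => //; exists x.
by exists x => //; exists y.
Qed.

(** Components are closed, so points are closed; the diagonal is then closed,
    being the preimage of 1 under division. *)
Lemma totally_disconnected_hausdorff :
  totally_disconnected [set: G] -> hausdorff_space G.
Proof.
move=> tdG x y; apply: contraPP => nxy clxy.
have ndiag : [set z : G | z <> 1%g] (x^-1 * y)%g.
  by move=> /(congr1 (fun z => (x * z)%g)); rewrite mulgA mulgV mul1g mulg1 => /esym.
have : nbhs (x^-1 * y)%g [set z : G | z <> 1%g].
  apply: open_nbhs_nbhs; split=> //.
  rewrite (_ : [set z | _] = ~` connected_component [set: G] 1%g).
    by apply: closed_openC; apply: component_closed; exact: closedT.
  by rewrite tdG.
have : (z.1^-1 * z.2)%g @[z --> (x, y)] --> (x^-1 * y)%g.
  apply: cvg_mulg; last exact: cvg_snd.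
  by apply: continuous_cvg; [exact: invg_continuous|exact: cvg_fst].
move=> /[apply] -[[A B] /= [xA yB] AB].
have [z [Az Bz]] := clxy _ _ xA yB.
by apply: (AB (z, z)) => //=; rewrite mulVg.
Qed.

(** * Powers of a generating set *)

(** The words have length exactly [n], rather than at most [n], so that each
    [words S n] is the image of a product of compact sets. *)
Fixpoint words S n : set G :=
  if n is m.+1 then [set (x * y)%g | x in S & y in words S m] else [set 1%g].

Lemma words_compact S n : compact S -> compact (words S n).
Proof.
move=> cS; elim: n => [|n IHn] /=; first exact: compact_set1.
exact: mulset_compact.
Qed.

Lemma words_mul S m n g h :
  words S m g -> words S n h -> words S (m + n) (g * h)%g.
Proof.
elim: m g => [|m IHm] g /=; first by move=> ->; rewrite mul1g.
move=> [x Sx [y wy <-]] wh; exists x => //; exists (y * h)%g; first exact: IHm.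
by rewrite mulgA.
Qed.

Lemma words_inv S n g : symmetric_set S -> words S n g -> words S n (g^-1)%g.
Proof.
move=> symS; elim: n g => [|n IHn] g; first by move=> /= ->; rewrite invg1.
move=> [x Sx [y wy <-]]; rewrite invgM -addn1.
apply: words_mul; first exact: IHn.
by exists (x^-1)%g; [exact: symS|exists 1%g; rewrite ?mulg1].
Qed.

(** The union contains [S], and symmetry of [S] makes it a subgroup. *)
Lemma bigcup_words S :
  symmetric_set S -> generates S -> \bigcup_n words S n = [set: G].
Proof.
move=> symS genS; apply/seteqP; split=> // g _.
have : smallest (@is_subgroup G) S g by rewrite genS.
apply; split; first split.
- by exists 0%N.
- by move=> x y [m _ wx] [n _ wy]; exists (m + n)%N => //; exact: words_mul.
- by move=> x [m _ wx]; exists m => //; exact: words_inv.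
by move=> x Sx; exists 1%N => //; exists x => //; exists 1%g; rewrite ?mulg1.
Qed.

Lemma words_seq S n g :
  words S n g ->
  exists s : seq G, [/\ size s = n, [set` s] `<=` S & (\prod_(x <- s) x)%g = g].
Proof.
elim: n g => [|n IHn] g /=; first by move=> ->; exists [::]; rewrite big_nil.
move=> [x Sx [_ /IHn[s [<- sS <-]] <-]]; exists (x :: s); split=> //.
  by move=> y /=; rewrite inE => /predU1P[->//|/sS].
by rewrite big_cons.
Qed.

Lemma word_metric_words (R : realType) S n g h :
  words S n h -> (word_metric R S g (g * h)%g <= n%:R%:E)%E.
Proof.
move=> /words_seq[s [<- sS prods]]; apply: ereal_inf_lbound; exists s => //.
by split=> //; rewrite prods mulgA mulVg mul1g.
Qed.

(** * Haar measure *)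

Section Haar.
Variables (R : realType) (mu : {measure set (borel G) -> \bar R}).
Hypothesis haar : left_haar mu.

Lemma borel_open A : open A -> measurable (A : set (borel G)).
Proof. exact: sub_gen_smallest. Qed.

Lemma borel_closed A : closed A -> measurable (A : set (borel G)).
Proof.
move=> cA; have /borel_open/measurableC : open (~` A) by exact: closed_openC.
by rewrite setCK.
Qed.

Lemma haar_gt0_compact : exists2 K, compact K & (0 < mu K)%E.
Proof.
have : (0 < mu [set: G])%E.
  by rewrite lt0e measure_ge0 andbT; apply/eqP; exact: haar_neq0 haar.
rewrite (haar_inner haar openT) => /ereal_sup_gt[_ [K [cK _] <-] muK].
by exists K.
Qed.

Lemma finite_lcoset_cover K A :
  compact K -> open A -> A 1%g ->
  exists s : seq G, K `<=` \bigcup_(g in [set` s]) [set (g * x)%g | x in A].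
Proof.
rewrite compact_cover => cK oA A1.
have [|g Kg|s _ Ks] := cK G K (fun g => [set (g * x)%g | x in A]).
- by move=> g _; exact: lcoset_open.
- by exists g => //; exists 1%g; rewrite ?mulg1.
by exists s.
Qed.

(** Finitely many translates of [A] cover a compact set of positive measure.
    Inner regularity of their union bounds the measure of the compact set
    even where compact sets may fail to be Borel. *)
Lemma haar_open_gt0 A : open A -> A 1%g -> (0 < mu A)%E.
Proof.
move=> oA A1; have [K cK muK] := haar_gt0_compact.
have [s Ks] := finite_lcoset_cover cK oA A1.
rewrite lt0e measure_ge0 andbT; apply/eqP => muA0.
have oU : open (\bigcup_(g in [set` s]) [set (g * x)%g | x in A]).
  by apply: bigcup_open => g _; exact: lcoset_open.
suff : (mu K <= 0)%E by rewrite leNgt muK.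
apply: (@le_trans _ _ (mu (\bigcup_(g in [set` s]) [set (g * x)%g | x in A]))).
  by rewrite (haar_inner haar oU); apply: ereal_sup_ubound; exists K.
rewrite bigcup_seq; elim: s {Ks oU} => [|g s IHs]; first by rewrite big_nil measure0.
rewrite big_cons; apply: le_trans (measureU2 _ _ _) _ => /=.
- by apply: borel_open; exact: lcoset_open.
- rewrite -bigcup_seq; apply: borel_open; apply: bigcup_open => h _.
  exact: lcoset_open.
by rewrite (haar_invariant haar) ?muA0 ?add0e//; exact: borel_open.
Qed.

Hypothesis hausG : hausdorff_space G.

Lemma borel_compact K : compact K -> measurable (K : set (borel G)).
Proof. by move=> cK; apply: borel_closed; exact: compact_closed cK. Qed.

(** Steinhaus: for [v] close to 1 the translate of [K] by [v] stays in an open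
    set of measure less than twice that of [K], so it cannot be disjoint from
    [K]. *)
Lemma haar_steinhaus K :
  compact K -> (0 < mu K)%E ->
  \forall v \near (1%g : G), exists2 x, K x & K (v * x)%g.
Proof.
move=> cK muK0; have mK := borel_compact cK.
have muKfin : mu K \is a fin_num.
  by rewrite ge0_fin_numE ?measure_ge0//; exact: haar_compact haar _ cK.
have : (mu K < mu K + mu K)%E by rewrite lteDl.
rewrite {1}(haar_outer haar mK) => /ereal_inf_lt[_ [U [oU KU] <-] ltU].
(* The tube lemma: compactness of [K] makes the neighbourhood of 1 uniform. *)
have : \forall v \near (1%g : G), K `<=` [set x | U (v * x)%g].
  have /compact_near_coveringP := cK; apply=> x Kx.
  have : (z.2 * z.1)%g @[z --> (x, 1%g : G)] --> x.
    by rewrite -[X in _ --> X]mul1g; apply: cvg_mulg; [exact: cvg_snd|exact: cvg_fst].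
  by apply; apply: open_nbhs_nbhs; split=> //; exact: KU.
apply: filterS => v vKU; apply: contrapT => disj.
move: ltU; apply/negP; rewrite -leNgt.
have cvK := lcoset_compact (g := v) cK.
rewrite -{2}(haar_invariant haar v mK) -measureU//; last 2 first.
- exact: borel_compact.
- apply/seteqP; split=> // y [Ky [x Kx vxy]]; apply: disj.
  by exists x; rewrite ?vxy.
apply: le_measure; rewrite ?inE.
- by apply: measurableU => //; exact: borel_compact.
- exact: borel_open.
- by rewrite subUset; split=> // _ [x /vKU Uvx <-].
Qed.

(** Some power of [S] has positive measure since they cover the group, so that
    by [haar_steinhaus] the power of twice its exponent is a neighbourhood of
    1. Finitely many translates of this neighbourhood cover [K], and each of
    the translating elements is itself a word in [S]. *)
Lemma compact_sub_words S K :
  compact S -> symmetric_set S -> generates S -> compact K ->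
  exists N, forall g, K g -> exists2 n, (n <= N)%N & words S n g.
Proof.
move=> cS symS genS cK; have uW := bigcup_words symS genS.
have [n muW] : exists n, (0 < mu (words S n))%E.
  apply: contrapT => /forallNP W0; apply: (haar_neq0 haar).
  have : mu.-negligible (\bigcup_n (words S n : set (borel G))).
    apply: negligible_bigcup => n; apply/negligibleP.
      exact: borel_compact (words_compact cS).
    by apply/eqP; rewrite eq_le measure_ge0 andbT leNgt; exact/negP/W0.
  by rewrite uW => /negligibleP; apply; exact: measurableT.
have /nbhs_interior := haar_steinhaus (words_compact (n := n) cS) muW.
set V : set G := _^°; move=> V1n.
have V1 : V 1%g by exact: nbhs_singleton.
have [s Ks] := finite_lcoset_cover cK (@open_interior _ _) V1.
have lens g : exists m, words S m g.
  by have : [set: G] g by []; rewrite -uW => -[m]; exists m.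
have [len lenE] := choice lens.
exists (\max_(g <- s) len g + (n + n))%N => _ /Ks[g gs [v Vv <-]].
exists (len g + (n + n))%N; first by rewrite leq_add2r; exact: leq_bigmax_seq.
apply: words_mul => //; have [x wx wvx] := interior_subset Vv.
by rewrite -(mulgK x v); apply: words_mul => //; exact: words_inv.
Qed.

End Haar.
End TopologicalGroups.

(** * Preimages of vertex sets under orbit maps *)

Section OrbitSets.
Variables (G : topologicalGroupType) (Gamma : graph) (a : graph_action G Gamma).
Implicit Types (x y : Gamma) (F : seq Gamma) (g h : G).

Lemma actVK g : cancel (a g) (a (g^-1)%g).
Proof. by move=> x; rewrite -actM mulVg act1. Qed.

Lemma orbit_ofP x y : orbit_of a x y <-> orbit_of a y = orbit_of a x.
Proof.
split=> [[h _ <-]|<-]; last by exists 1%g; rewrite ?act1.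
apply/seteqP; split=> _ [g _ <-].
  by exists (g * h)%g; rewrite ?actM.
by exists (g * h^-1)%g; rewrite ?actM ?actVK.
Qed.

Lemma orbit_map_open x y : open [set g | a g x = y].
Proof.
apply: (@open_comp _ (discrete_topology Gamma) (fun g => a g x) [set y]).
  move=> g _; have /pointwise_cvgP := @act_continuous _ _ a g.
  exact.
exact: discrete_open.
Qed.

Lemma orbit_map_fibre x g :
  [set h | a h x = a g x] = [set (g * h)%g | h in stabiliser a x].
Proof.
apply/seteqP; split=> [h hx|_ [h hx <-]] /=; last by rewrite actM hx.
by exists (g^-1 * h)%g; rewrite /stabiliser /= ?actM ?hx ?actVK// mulVKg.
Qed.

Lemma stabiliser_open x : open (stabiliser a x).
Proof. exact: orbit_map_open. Qed.

Definition orbit_preimage x F : set G := [set g | a g x \in F].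

Lemma orbit_preimage_cons x y F :
  orbit_preimage x (y :: F) = [set g | a g x = y] `|` orbit_preimage x F.
Proof.
apply/seteqP; split=> g; rewrite /orbit_preimage /= inE.
  by case/predU1P; [left|right].
by case=> [->|->]; rewrite ?eqxx ?orbT.
Qed.

Lemma orbit_preimage_nil x : orbit_preimage x [::] = set0.
Proof. by apply/seteqP; split. Qed.

Lemma orbit_preimage_open x F : open (orbit_preimage x F).
Proof.
elim: F => [|y F IHF]; first by rewrite orbit_preimage_nil; exact: open0.
by rewrite orbit_preimage_cons; apply: openU => //; exact: orbit_map_open.
Qed.

Lemma orbit_map_outside x y : ~ orbit_of a x y -> [set g | a g x = y] = set0.
Proof. by move=> nxy; apply/seteqP; split=> // g gxy; apply: nxy; exists g. Qed.

Lemma orbit_preimage_compact x F :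
  proper_action a -> compact (orbit_preimage x F).
Proof.
move=> properA; elim: F => [|y F IHF].
  by rewrite orbit_preimage_nil; exact: compact0.
rewrite orbit_preimage_cons; apply: compactU => //.
have [[g _ <-]|nxy] := pselect (orbit_of a x y).
  by rewrite orbit_map_fibre; apply: lcoset_compact; exact: properA.
by rewrite orbit_map_outside//; exact: compact0.
Qed.

(** The preimage of each vertex is empty or a left coset of the stabiliser,
    according to whether the vertex is in the orbit of [x]. Membership in the
    orbit is expressed as an equality of orbits so that it is a fibre of the
    map [orbit_of a], as in [fibre_pigeonhole]. *)
Lemma haar_orbit_preimage (R : realType) (mu : {measure set (borel G) -> \bar R})
    x F :
  left_haar mu -> uniq F ->
  mu (orbit_preimage x F) =
    ((count (fun y => orbit_of a y == orbit_of a x) F)%:R%:E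
       * mu (stabiliser a x))%E.
Proof.
move=> haar; elim: F => [_|y F IHF /= /andP[yF uF]].
  by rewrite orbit_preimage_nil measure0 mul0e.
have muU : (mu ([set g | a g x = y] `|` orbit_preimage x F)
    = mu [set g | a g x = y] + mu (orbit_preimage x F))%E.
  apply: measureU.
  - exact: borel_open (orbit_map_open x y).
  - exact: borel_open (orbit_preimage_open x F).
  - apply/seteqP; split=> // g [/= gxy]; rewrite /orbit_preimage /= gxy.
    exact/negP.
rewrite orbit_preimage_cons muU IHF// natrD EFinD ge0_muleDl ?lee_fin//; congr (_ + _)%E.
have [/orbit_ofP[g _ <-]|/eqP nxy] := eqVneq.
  rewrite mul1e orbit_map_fibre (haar_invariant haar)//.
  exact: borel_open (stabiliser_open x).
by rewrite mul0e orbit_map_outside ?measure0// => /orbit_ofP.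
Qed.

(** The length bound involves only [C] and [N], so that one radius serves the
    base points of all orbits. *)
Lemma lipschitz_path (R : realType) (C : R) S x N n g h :
  0 < C ->
  (forall g h,
    (graph_dist R (a g x) (a h x) <= C%:E * word_metric R S g h)%E) ->
  (n <= N)%N -> words S n h ->
  exists p, [/\ path (@adj Gamma) (a g x) p, last (a g x) p = a (g * h)%g x
    & (size p <= Num.bound (C * N%:R))%N].
Proof.
move=> C0 lipx leqnN wh.
have : (graph_dist R (a g x) (a (g * h)%g x) < (Num.bound (C * N%:R))%:R%:E)%E.
  apply: le_lt_trans (lipx _ _) _.
  apply: (@le_lt_trans _ _ (C * N%:R)%:E).
    rewrite EFinM lee_pmul2l// ?lte_fin//.
    by apply: le_trans (word_metric_words _ _ wh) _; rewrite lee_fin ler_nat.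
  by rewrite lte_fin archi_boundP// mulr_ge0// ltW.
move=> /ereal_inf_lt[_ [p [xp lastp] <-]]; rewrite lte_fin ltr_nat => ltp.
by exists p; split=> //; exact: ltnW.
Qed.

End OrbitSets.

(** * Geometric amenability *)

Theorem theorem1p4 (R : realType) (G : topologicalGroupType)
    (mu : {measure set (borel G) -> \bar R})
    (Gamma : graph) (a : graph_action G Gamma) :
  left_haar mu ->
  locally_compact [set: G] ->
  totally_disconnected [set: G] ->
  compactly_generated G ->
  bounded_degree Gamma ->
  amenable_graph Gamma R ->
  proper_action a ->
  lipschitz_action a R ->
  geometrically_amenable mu.
Proof.
move=> haar _ tdG _ bdG ameG properA [C C0 [S [cS symS genS lipS]]].
move=> K eps cK eps0; have hausG := totally_disconnected_hausdorff tdG.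
have [N KN] := compact_sub_words haar hausG cS symS genS cK.
have [A [E [A0 uAE leEA AE]]] :=
  amenable_small_thickening (Num.bound (C * N%:R)) bdG ameG eps0.
(* The orbit is chosen through [y]; only then is [y] replaced by the point [x]
   of its orbit at which the orbit map is Lipschitz. *)
have [y yA ley] := fibre_pigeonhole (orbit_of a) A0 leEA.
have [x yx lipx] := lipS y.
move/orbit_ofP: yx ley => xy; rewrite -xy; set inOx := fun z => _ == _ => ley.
have stab0 : (0 < mu (stabiliser a x))%E.
  by apply: (haar_open_gt0 haar); [exact: stabiliser_open|exact: act1].
have stabfin : mu (stabiliser a x) \is a fin_num.
  by rewrite ge0_fin_numE ?measure_ge0//; exact: haar_compact haar _ (properA x).
have [r r0 stabE] : exists2 r : R, 0 < r & mu (stabiliser a x) = r%:E.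
  exists (fine (mu (stabiliser a x))); last by rewrite fineK.
  by rewrite -lte_fin fineK.
have muE F : uniq F -> mu (orbit_preimage a x F) = ((count inOx F)%:R * r)%:E.
  by move=> uF; rewrite (haar_orbit_preimage _ _ haar uF) stabE.
have uA : uniq A by move: uAE; rewrite cat_uniq => /andP[].
have cA0 : 0 < (count inOx A)%:R :> R.
  rewrite ltr0n -has_count; apply/hasP; exists y => //.
  by rewrite /inOx xy.
pose U := orbit_preimage a x A; have oU : open U := orbit_preimage_open a x A.
have UK : [set (u * k)%g | u in U & k in K] `<=` orbit_preimage a x (A ++ E).
  move=> _ [g Ug [k Kk <-]]; have [n leqnN wk] := KN k Kk.
  have [p [pathp lastp lep]] := lipschitz_path g C0 lipx leqnN wk.
  by rewrite /orbit_preimage /= -lastp; exact: AE.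
exists U; split.
- exact: orbit_preimage_compact.
- by rewrite muE// lte_fin mulr_gt0.
rewrite (muE A uA) inver gt_eqF ?mulr_gt0// lee_pdivrMr ?mulr_gt0//.
apply: (@le_trans _ _ (mu (orbit_preimage a x (A ++ E)))).
  apply: le_measure; rewrite ?inE//.
  - exact: borel_open (mulset_open K oU).
  - exact: borel_open (orbit_preimage_open a x (A ++ E)).
rewrite muE// lee_fin count_cat natrD mulrA ler_pM2r// mulrDl mul1r lerD2l.
exact: ley.
Qed.
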